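(* Consider the problem (PC) described in the context. Let $g(\cdot,x,y,t)$ be a continuous convex proper function and $F(\cdot,x,y,t):\mathbb{R}^n\rightrightarrows\mathbb{R}^n$ a convex set-valued mapping. Then for the optimality of the solution $\tilde u(x,y,t)$ in the first mixed problem (PC) with parabolic differential inclusion and Laplace operator it is sufficient that there exists a classical solution $u^*(x,y,t)$ satisfying the following conditions (i)-(iii): (i) $\displaystyle -\frac{\partial u^*(x,y,t)}{\partial t}-\Delta u^*(x,y,t)\in F^*\Big(u^*(x,y,t);\Big(\tilde u(x,y,t),\frac{\partial\tilde u(x,y,t)}{\partial t}-\Delta\tilde u(x,y,t)\Big),x,y,t\Big)-\partial g(\tilde u(x,y,t),x,y,t)$, $(x,y,t)\in D\times[0,T]$; (ii) $u^*(x,y,T)=u^*(x,0,t)=u^*(x,S,t)=u^*(0,y,t)=u^*(L,y,t)=0$; (iii) $\displaystyle \frac{\partial\tilde u(x,y,t)}{\partial t}-\Delta\tilde u(x,y,t)\in F_A\big(\tilde u(x,y,t);u^*(x,y,t),x,y,t\big)$.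
   Context: Problem (PC). $L,S,T>0$, $D=[0,L]\times[0,S]$, $\Delta=\frac{\partial^2}{\partial x^2}+\frac{\partial^2}{\partial y^2}$. Given $F(\cdot,x,y,t):\mathbb{R}^n\rightrightarrows\mathbb{R}^n$, $g(\cdot,x,y,t)$, and continuous functions $\alpha:D\to\mathbb{R}^n$, $\beta_0,\beta_S:[0,L]\times[0,T]\to\mathbb{R}^n$, $\gamma_0,\gamma_L:[0,S]\times[0,T]\to\mathbb{R}^n$, minimize $$J[u(\cdot,\cdot,\cdot)]=\int_0^T\iint_D g(u(x,y,t),x,y,t)\,dx\,dy\,dt$$ over feasible solutions, i.e. classical solutions $u$ of $$\frac{\partial u(x,y,t)}{\partial t}-\Delta u(x,y,t)\in F(u(x,y,t),x,y,t),\quad (x,y,t)\in D\times[0,T],$$ $$u(x,y,0)=\alpha(x,y),\ u(x,0,t)=\beta_0(x,t),\ u(x,S,t)=\beta_S(x,t),\ u(0,y,t)=\gamma_0(y,t),\ u(L,y,t)=\gamma_L(y,t).$$ A feasible $\tilde u$ is optimal if $J[\tilde u]\le J[u]$ for all feasible $u$. Classical solutions. Let $P_T=D\times(0,T)$, $\Gamma_T=\{(x,y)\in\partial D,\ 0<t<T\}$, $D_0=\{(x,y)\in D,t=0\}$. A classical solution is a function $u\in C^{2,1}(P_T)\cap C(P_T\cup\Gamma_T\cup\bar D_0)$ satisfying the inclusion, the initial condition on $D_0$ and the boundary conditions on $\Gamma_T$, where $C^{2,1}(P_T)$ is the space of continuous functions with continuous partial derivatives $u_x,u_y,u_t,u_{xx},u_{yy}$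 in $P_T$. Similarly, $u^*$ being a classical solution means that it has this regularity (with the final face $t=T$, where data are prescribed in (ii), in place of the initial face) and satisfies the adjoint inclusion (i) and the homogeneous end-point and boundary conditions (ii). Notation. $\mathrm{gph}\,F=\{(u,v):v\in F(u)\}$; $F$ is convex if $\mathrm{gph}\,F$ is convex; $H_F(u,v^* )=\sup\{\langle v,v^*\rangle:v\in F(u)\}$; $F_A(u;v^* )=\{v\in F(u):\langle v,v^*\rangle=H_F(u,v^* )\}$. For convex $F$ and $(u,v)\in\mathrm{gph}\,F$: $K_F(u,v)=\{\mu((\tilde u,\tilde v)-(u,v)):\mu>0,(\tilde u,\tilde v)\in\mathrm{gph}\,F\}$, $K_F^*(u,v)$ is its dual cone $\{z^*:\langle\bar z,z^*\rangle\ge0\ \forall\bar z\in K_F(u,v)\}$, and the locally adjoint mapping is $F^*(v^*;(u,v))=\{u^*:(u^*,-v^* )\in K_F^*(u,v)\}$; when $v\in F_A(u;v^* )$ it equals $\{u^*:H_F(\tilde u,v^* )-H_F(u,v^* )\le\langle u^*,\tilde u-u\rangle\ \forall\tilde u\in\mathbb{R}^n\}$ (with $H_F(\tilde u,v^* )$ read as $-\infty$ when $F(\tilde u)=\varnothing$, the supremum over the empty set). All these are taken with $x,y,t$ as parameters. $\partial g$ is the convex subdifferential in the first argument. A function is proper if it never equals $-\infty$ and is not identically $+\infty$.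
   Formalization: The feasible solutions u (including ũ) and the adjoint solution u* are additionally required to be bounded on D×(0,T), without which the claim fails, and the integral J[u] is assumed to exist (possibly infinite) for every feasible u. *)

(* Defs.v *)
From HB Require Import structures.
From mathcomp Require Export all_boot all_order all_algebra.
From mathcomp Require Export all_classical all_reals all_analysis
  measurable_realfun.
Export Order.TTheory GRing.Theory Num.Theory numFieldNormedType.Exports.

Set Implicit Arguments.
Unset Strict Implicit.
Unset Printing Implicit Defensive.

Local Open Scope classical_set_scope.
Local Open Scope ring_scope.

Definition dotv (R : realType) (n : nat) (u v : 'rV[R]_n) : R :=
  \sum_(i < n) u ord0 i * v ord0 i.

(** * Set-valued mappings *)

Definition gph (R : realType) (n : nat) (G : 'rV[R]_n -> set 'rV[R]_n)
    : set ('rV[R]_n * 'rV[R]_n) :=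
  [set p | G p.1 p.2].

Definition convex_mapping (R : realType) (n : nat)
    (G : 'rV[R]_n -> set 'rV[R]_n) : Prop :=
  @convex_set R ('rV[R]_n * 'rV[R]_n)%type (gph G).

(* [ereal_sup set0] is [-oo]: the supremum over the empty set. *)
Definition Hamiltonian (R : realType) (n : nat)
    (G : 'rV[R]_n -> set 'rV[R]_n) (u vs : 'rV[R]_n) : \bar R :=
  ereal_sup [set (dotv v vs)%:E | v in G u].

Definition argmax_set (R : realType) (n : nat)
    (G : 'rV[R]_n -> set 'rV[R]_n) (u vs : 'rV[R]_n) : set 'rV[R]_n :=
  [set v | G u v /\ (dotv v vs)%:E = Hamiltonian G u vs].

Definition tangent_cone (R : realType) (n : nat)
    (G : 'rV[R]_n -> set 'rV[R]_n) (w : 'rV[R]_n * 'rV[R]_n)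
    : set ('rV[R]_n * 'rV[R]_n) :=
  [set z | exists (mu : R) (w' : 'rV[R]_n * 'rV[R]_n),
     [/\ 0 < mu, gph G w' & z = mu *: (w' - w)]].

Definition dual_cone (R : realType) (n : nat)
    (K : set ('rV[R]_n * 'rV[R]_n)) : set ('rV[R]_n * 'rV[R]_n) :=
  [set zs | forall z, K z -> 0 <= dotv z.1 zs.1 + dotv z.2 zs.2].

(* The locally adjoint mapping G^*(vs; w). *)
Definition LAM (R : realType) (n : nat) (G : 'rV[R]_n -> set 'rV[R]_n)
    (vs : 'rV[R]_n) (w : 'rV[R]_n * 'rV[R]_n) : set 'rV[R]_n :=
  [set us | dual_cone (tangent_cone G w) (us, - vs)].

(** * Extended-real functions *)

Definition proper (R : realType) (n : nat) (h : 'rV[R]_n -> \bar R) : Prop :=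
  (forall u, h u != -oo%E) /\ (exists u, h u != +oo%E).

(* Used for proper [h] only, so no [+oo - oo] arises on the right. *)
Definition convex_efun (R : realType) (n : nat)
    (h : 'rV[R]_n -> \bar R) : Prop :=
  forall (u v : 'rV[R]_n) (a : R), 0 < a -> a < 1 ->
    (h (a *: u + (1 - a) *: v)%R <= a%:E * h u + (1 - a)%:E * h v)%E.

(* For proper [h] this is empty wherever [h u] is [+oo]. *)
Definition subdifferential (R : realType) (n : nat)
    (h : 'rV[R]_n -> \bar R) (u : 'rV[R]_n) : set 'rV[R]_n :=
  [set us | forall v, (h u + (dotv us (v - u)%R)%:E <= h v)%E].

(** * The cylinder and partial derivatives *)

Definition rect (R : realType) (L S : R) : set (R * R) :=
  `[0, L]%classic `*` `[0, S]%classic.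

Definition cyl (R : realType) (L S T : R) : set (R * R * R) :=
  rect L S `*` `]0, T[%classic.

Definition unc (R : realType) (V : Type) (u : R -> R -> R -> V)
    (p : R * R * R) : V :=
  u p.1.1 p.1.2 p.2.

(* The rectangle is closed, so at its edges the derivatives in x and y are
   one-sided: the increments stay in the interval [A]. *)
Definition dquot (R : realType) (n : nat) (f : R -> 'rV[R]_n) (x z : R)
    : 'rV[R]_n :=
  (z - x)^-1 *: (f z - f x).

Definition derivable_within (R : realType) (n : nat) (A : set R)
    (f : R -> 'rV[R]_n) (x : R) : Prop :=
  cvg (dquot f x @ within A x^').

Definition derive_within (R : realType) (n : nat) (A : set R)
    (f : R -> 'rV[R]_n) (x : R) : 'rV[R]_n :=
  lim (dquot f x @ within A x^').

Section PartialDerivatives.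
Context {R : realType} {n : nat}.
Implicit Types (L S T x y t : R) (u : R -> R -> R -> 'rV[R]_n).

Definition dx L u x y t : 'rV[R]_n :=
  derive_within `[0, L]%classic (fun z => u z y t) x.

Definition dy S u x y t : 'rV[R]_n :=
  derive_within `[0, S]%classic (fun z => u x z t) y.

Definition dt u x y t : 'rV[R]_n := derive1 (u x y) t.

Definition laplacian L S u x y t : 'rV[R]_n :=
  dx L (dx L u) x y t + dy S (dy S u) x y t.

Definition C21 L S T u : Prop :=
  [/\ forall x y t, cyl L S T (x, y, t) ->
        [/\ derivable_within `[0, L]%classic (fun z => u z y t) x,
            derivable_within `[0, S]%classic (fun z => u x z t) y,
            derivable (u x y) t 1,
            derivable_within `[0, L]%classic (fun z => dx L u z y t) x &
            derivable_within `[0, S]%classic (fun z => dy S u x z t) y],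
      {within cyl L S T, continuous (unc u)},
      {within cyl L S T, continuous (unc (dt u))},
      {within cyl L S T, continuous (unc (dx L u))} /\
      {within cyl L S T, continuous (unc (dy S u))} &
      {within cyl L S T, continuous (unc (dx L (dx L u)))} /\
      {within cyl L S T, continuous (unc (dy S (dy S u)))}].

End PartialDerivatives.

(* As [rect] is closed, the lateral boundary is contained in [cyl], and the
   union of [cyl] with the bottom (resp. top) face is rect x [0,T[ (resp.
   rect x ]0,T]).

   Continuity up to one time face says nothing about the other one, yet the
   inclusions are posed for t in the closed interval [0,T].  The regularity up
   to both faces that this presupposes is kept here in the weak form of
   boundedness.  It cannot be dropped: take n = 1,
   phi = sin(pi x/L) sin(pi y/S), Laplacian phi = - lam phi,
   F(u) = {(lam + 1/t) u}, g(u) = - phi u/(T t), and zero data.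
   Then 0 and t phi are feasible, u* = (1/t - 1/T) phi satisfies the adjoint
   conditions for the solution 0 and vanishes at t = T and on the edges, but
   J[t phi] < 0 = J[0]. *)
Definition primal_regular (R : realType) (n : nat) (L S T : R)
    (u : R -> R -> R -> 'rV[R]_n) : Prop :=
  [/\ C21 L S T u,
      {within rect L S `*` `[0, T[%classic, continuous (unc u)} &
      [bounded unc u p | p in cyl L S T]].

Definition adjoint_regular (R : realType) (n : nat) (L S T : R)
    (us : R -> R -> R -> 'rV[R]_n) : Prop :=
  [/\ C21 L S T us,
      {within rect L S `*` `]0, T]%classic, continuous (unc us)} &
      [bounded unc us p | p in cyl L S T]].

(** * Problem (PC) *)

Definition boundary_values (R : realType) (n : nat) (L S T : R)
    (b0 bS c0 cL : R -> R -> 'rV[R]_n) (u : R -> R -> R -> 'rV[R]_n) : Prop :=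
  (forall x t, 0 <= x <= L -> 0 < t < T ->
     u x 0 t = b0 x t /\ u x S t = bS x t) /\
  (forall y t, 0 <= y <= S -> 0 < t < T ->
     u 0 y t = c0 y t /\ u L y t = cL y t).

Definition feasible (R : realType) (n : nat) (L S T : R)
    (F : 'rV[R]_n -> R -> R -> R -> set 'rV[R]_n)
    (alpha b0 bS c0 cL : R -> R -> 'rV[R]_n)
    (u : R -> R -> R -> 'rV[R]_n) : Prop :=
  [/\ primal_regular L S T u,
      forall x y t, cyl L S T (x, y, t) ->
        F (u x y t) x y t (dt u x y t - laplacian L S u x y t),
      forall x y, rect L S (x, y) -> u x y 0 = alpha x y &
      boundary_values L S T b0 bS c0 cL u].

(* [R * R * R] with its Borel product sigma-algebra. *)
Definition mspace3 (R : realType) :=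
  (measurableTypeR R * measurableTypeR R * measurableTypeR R)%type.

Definition cost (R : realType) (n : nat)
    (g : 'rV[R]_n -> R -> R -> R -> \bar R) (u : R -> R -> R -> 'rV[R]_n)
    (p : mspace3 R) : \bar R :=
  g (unc u p) p.1.1 p.1.2 p.2.

Definition mu3 (R : realType) :=
  ((@lebesgue_measure R \x @lebesgue_measure R) \x @lebesgue_measure R)%E.

(* The integral is taken over rect x ]0,T[ : a solution has no prescribed
   values at t = T, and the two time faces are null sets. *)
Definition J (R : realType) (n : nat) (L S T : R)
    (g : 'rV[R]_n -> R -> R -> R -> \bar R) (u : R -> R -> R -> 'rV[R]_n)
    : \bar R :=
  (\int[@mu3 R]_(p in cyl L S T) cost g u p)%E.

(* The integral defining [J] exists, possibly with an infinite value. *)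
Definition J_exists (R : realType) (n : nat) (L S T : R)
    (g : 'rV[R]_n -> R -> R -> R -> \bar R) (u : R -> R -> R -> 'rV[R]_n)
    : Prop :=
  measurable_fun (cyl L S T : set (mspace3 R)) (cost g u) /\
  ((\int[@mu3 R]_(p in cyl L S T) (cost g u)^\+ p < +oo)%E \/
   (\int[@mu3 R]_(p in cyl L S T) (cost g u)^\- p < +oo)%E).

Definition optimal (R : realType) (n : nat) (L S T : R)
    (F : 'rV[R]_n -> R -> R -> R -> set 'rV[R]_n)
    (g : 'rV[R]_n -> R -> R -> R -> \bar R)
    (alpha b0 bS c0 cL : R -> R -> 'rV[R]_n)
    (u : R -> R -> R -> 'rV[R]_n) : Prop :=
  feasible L S T F alpha b0 bS c0 cL u /\
  forall v, feasible L S T F alpha b0 bS c0 cL v ->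
    (J L S T g u <= J L S T g v)%E.

(** * The sufficient conditions *)

(* The difference of sets is the Minkowski one. *)
Definition adjoint_inclusion (R : realType) (n : nat) (L S T : R)
    (F : 'rV[R]_n -> R -> R -> R -> set 'rV[R]_n)
    (g : 'rV[R]_n -> R -> R -> R -> \bar R)
    (u us : R -> R -> R -> 'rV[R]_n) : Prop :=
  forall x y t, cyl L S T (x, y, t) ->
    [set a - b |
       a in LAM (fun v => F v x y t) (us x y t)
              (u x y t, dt u x y t - laplacian L S u x y t) &
       b in subdifferential (fun v => g v x y t) (u x y t)]
    (- dt us x y t - laplacian L S us x y t).

Definition adjoint_zero_data (R : realType) (n : nat) (L S T : R)
    (us : R -> R -> R -> 'rV[R]_n) : Prop :=
  (forall x y, rect L S (x, y) -> us x y T = 0) /\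
  boundary_values L S T (fun _ _ => 0) (fun _ _ => 0)
    (fun _ _ => 0) (fun _ _ => 0) us.

Definition maximum_condition (R : realType) (n : nat) (L S T : R)
    (F : 'rV[R]_n -> R -> R -> R -> set 'rV[R]_n)
    (u us : R -> R -> R -> 'rV[R]_n) : Prop :=
  forall x y t, cyl L S T (x, y, t) ->
    argmax_set (fun v => F v x y t) (u x y t) (us x y t)
      (dt u x y t - laplacian L S u x y t).

(* Main.v *)
From HB Require Import structures.
From mathcomp Require Import ring lra.
Require Import Defs.

(** Write [P = d/dt - Laplacian] for the heat operator and
    [P* = - d/dt - Laplacian] for its formal adjoint.  Let [v] be any feasible
    solution and [w = v - u].  At each point of the cylinder the adjoint
    inclusion writes [P* us] as [a - b], with [a] in the locally adjoint mapping
    and [b] a subgradient of [g] at [u].  Testing [a] on the direction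
    [(w, P v - P u)] and [b] on [w] gives
    [g(u) + (<P w, us> - <w, P* us>) <= g(v)] ([adjoint_pointwise]).

    It remains to see that the middle term integrates to zero.  It is a sum of
    exact derivatives in t, x and y.  Those in x and y integrate to zero, since
    [w] and [us] vanish on the lateral boundary, and the one in t leaves the
    integrals of [<w, us>] over the rectangle at the two time ends
    ([green_box]).  At t = 0 the first factor vanishes and at t = T the second.

    Regularity up to the time ends is lacking: the derivatives may blow up
    there, so the middle term need not be integrable on the whole cylinder.  The
    computation is therefore done between the times [margin T k] and
    [T - margin T k], where everything is bounded; the time-end terms tend to
    zero by dominated convergence, as [w] and [us] are bounded
    ([cvg_integral_green]).  The costs may be non-integrable too, and
    [le_integral_exhaustion] passes to the limit in the inequality between
    them. *)

Set Implicit Arguments.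
Unset Strict Implicit.
Unset Printing Implicit Defensive.

Local Open Scope classical_set_scope.
Local Open Scope ring_scope.

(** * The scalar product of row vectors *)

Section Dotv.
Context {R : realType} {n : nat}.
Implicit Types u v w : 'rV[R]_n.

Lemma dotvDl u v w : dotv (u + v) w = dotv u w + dotv v w.
Proof. by rewrite -big_split; apply: eq_bigr => i _; rewrite mxE mulrDl. Qed.

Lemma dotvDr u v w : dotv u (v + w) = dotv u v + dotv u w.
Proof. by rewrite -big_split; apply: eq_bigr => i _; rewrite mxE mulrDr. Qed.

Lemma dotvZl (a : R) u v : dotv (a *: u) v = a * dotv u v.
Proof. by rewrite mulr_sumr; apply: eq_bigr => i _; rewrite mxE mulrA. Qed.

Lemma dotvZr (a : R) u v : dotv u (a *: v) = a * dotv u v.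
Proof. by rewrite mulr_sumr; apply: eq_bigr => i _; rewrite mxE mulrCA. Qed.

Lemma dotvNl u v : dotv (- u) v = - dotv u v.
Proof. by rewrite -scaleN1r dotvZl mulN1r. Qed.

Lemma dotvNr u v : dotv u (- v) = - dotv u v.
Proof. by rewrite -scaleN1r dotvZr mulN1r. Qed.

Lemma dotv0l v : dotv 0 v = 0.
Proof. by rewrite -(scale0r 0) dotvZl mul0r. Qed.

Lemma dotv0r v : dotv v 0 = 0.
Proof. by rewrite -(scale0r 0) dotvZr mul0r. Qed.

Lemma dotvC u v : dotv u v = dotv v u.
Proof. by apply: eq_bigr => i _; rewrite mulrC. Qed.

Lemma dotv_le u v : `|dotv u v| <= n%:R * (`|u| * `|v|).
Proof.
apply: (le_trans (ler_norm_sum _ _ _)).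
rewrite mulr_natl -[X in _ *+ X](card_ord n) -sumr_const.
apply: ler_sum => i _; rewrite normrM.
by apply: ler_pM => //; rewrite [leRHS]mx_normrE;
  apply: (le_trans _ (le_bigmax _ _ (ord0, i))).
Qed.

Lemma cvg_dotv (T : Type) (F : set_system T) (FF : Filter F)
    (f g : T -> 'rV[R]_n) (a b : 'rV[R]_n) :
  f @ F --> a -> g @ F --> b -> dotv (f x) (g x) @[x --> F] --> dotv a b.
Proof.
move=> fa gb; apply: (cvg_big (op := +%R) (x0 := 0)) => [[x y]|i _].
  exact: add_continuous.
apply: cvgM.
- exact: (cvg_comp _ _ fa (@coord_continuous _ _ _ ord0 i a)).
- exact: (cvg_comp _ _ gb (@coord_continuous _ _ _ ord0 i b)).
Qed.

Lemma within_continuous_dotv (T : topologicalType) (A : set T)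
    (f g : T -> 'rV[R]_n) :
  {within A, continuous f} -> {within A, continuous g} ->
  {within A, continuous (fun x => dotv (f x) (g x))}.
Proof. by move=> cf cg x; apply: cvg_dotv; [exact: cf|exact: cg]. Qed.

End Dotv.

(** * One-sided derivatives and Green's identity on a segment *)

Section WithinDerivative.
Context {R : realType} {V : normedModType R}.
Implicit Types (f g : R -> V) (A : set R) (x : R) (d : V).

(** The relational form of the one-sided derivative: [derivable_within A f x]
    unfolds to this statement about [derive_within A f x].  Keeping the
    derivative as a parameter lets derivatives be subtracted and multiplied
    without going back to limits. *)
Definition has_derive_within A f x d :=
  (z - x)^-1 *: (f z - f x) @[z --> within A x^'] --> d.

Lemma cvg_dnbhs_within_derive A f x d : has_derive_within A f x d ->
  f @ within A x^' --> f x.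
Proof.
move=> fd.
have zx : (z - x) @[z --> within A x^'] --> (0 : R).
  rewrite -(subrr x); apply: cvgB; last exact: cvg_cst.
  apply: cvg_trans; [exact: cvg_within|exact: cvg_within].
have h : (z - x) *: ((z - x)^-1 *: (f z - f x)) + f x
    @[z --> within A x^'] --> f x.
  rewrite -[X in _ --> X]add0r -(scale0r d).
  by apply: cvgD; [exact: cvgZ|exact: cvg_cst].
apply: (cvg_trans _ h); apply: near_eq_cvg; rewrite near_withinE.
near=> z => _; rewrite scalerA divff ?scale1r ?subrK//.
rewrite subr_eq0; near: z; exact: nbhs_dnbhs_neq.
Unshelve. all: by end_near. Qed.

Lemma cvg_within_derive A f x d : has_derive_within A f x d ->
  f @ within A (nbhs x) --> f x.
Proof.
move=> /cvg_dnbhs_within_derive fx; apply/cvgrPdist_lt => e e0.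
move/cvgrPdist_lt/(_ _ e0) : fx; rewrite !near_withinE.
apply: filterS => z zA Az.
by have [->|/zA] := eqVneq z x; [rewrite subrr normr0|exact].
Qed.

(** For the time derivative, which is two-sided because the cylinder is open in
    time. *)
Lemma derivable_has_derive_within A f x : derivable f x 1 ->
  has_derive_within A f x (derive1 f x).
Proof.
move=> fx; rewrite derive1E.
apply: cvg_trans (_ : (z - x)^-1 *: (f z - f x) @[z --> x^'] --> _).
  exact/cvg_app/cvg_within.
apply/cvgrPdist_lt => e e0.
move/cvgrPdist_lt/(_ _ e0) : (fx) => /= /nbhs_ballP[r r0 rP].
apply/nbhs_ballP; exists r => //= z xz zx.
have := rP (z - x); rewrite /= subr_eq0 => /(_ _ zx).
rewrite [_%:A]mulr1 subrK; apply.
by rewrite /ball /= sub0r normrN distrC.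
Qed.

Lemma has_derive_withinB A f g x (d e : V) :
  has_derive_within A f x d -> has_derive_within A g x e ->
  has_derive_within A (fun z => f z - g z) x (d - e).
Proof.
move=> fd ge.
have h : (z - x)^-1 *: (f z - f x) - (z - x)^-1 *: (g z - g x)
    @[z --> within A x^'] --> d - e by exact: cvgB.
apply: (cvg_trans _ h); apply: near_eq_cvg; near=> z.
by rewrite -scalerBr !opprD !opprK addrACA.
Unshelve. all: by end_near. Qed.

Lemma has_derive_within_interior (a b x : R) f d : a < x < b ->
  has_derive_within `[a, b]%classic f x d -> is_derive x (1 : R) f d.
Proof.
move=> /andP[ax xb] fd.
have h : h^-1 *: ((f \o shift x) (h *: (1:R)) - f x) @[h --> 0^'] --> d.
  apply/cvgrPdist_lt => e e0.
  move/cvgrPdist_lt/(_ _ e0) : fd => /nbhs_ballP[r /= r0 rP].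
  near=> h; have := rP (h + x); rewrite /= addrK [_%:A]mulr1; apply.
  - rewrite /ball /= opprD addrCA subrr addr0 normrN.
    by near: h; apply: dnbhs0_lt.
  - rewrite -subr_eq0 addrK; near: h; exact: nbhs_dnbhs_neq.
  - rewrite in_itv /= -lerBlDr -[h + x <= b]lerBrDr.
    have hr : `|h| <= Num.min (x - a) (b - x).
      by near: h; apply: dnbhs0_le; rewrite lt_min !subr_gt0 ax.
    move: hr; rewrite le_min !ler_norml => /andP[/andP[+ _] /andP[_ ->]].
    by rewrite opprB => ->.
apply: DeriveDef; first by apply/cvg_ex; exists d.
exact: cvg_lim h.
Unshelve. all: by end_near. Qed.

End WithinDerivative.

(** The derivative at the endpoints is only used for continuity there; inside
    the interval it is the ordinary derivative. *)
Lemma FTC_within (R : realType) (F f : R -> R) (a b : R) : a < b ->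
  (forall x, a <= x <= b ->
     has_derive_within `[a, b]%classic (F : R -> R^o) x (f x)) ->
  {within `[a, b]%classic, continuous f} ->
  (\int[@lebesgue_measure R]_(x in `[a, b]) (f x)%:E = (F b - F a)%:E)%E.
Proof.
move=> ab Ff cf; rewrite EFinB; apply: continuous_FTC2 => //.
- have Fc : {within `[a, b]%classic, continuous (F : R -> R^o)}.
    apply/subspace_continuousP => x /=; rewrite in_itv /= => xab.
    exact: cvg_within_derive (Ff x xab).
  have [_ Fa Fb] := (continuous_within_itvP _ ab).1 Fc.
  split=> // x; rewrite in_itv /= => xab.
  have xab' : a <= x <= b by case/andP: xab => /ltW -> /ltW ->.
  by have [] := has_derive_within_interior xab (Ff x xab').
- move=> x; rewrite in_itv /= => xab.
  have xab' : a <= x <= b by case/andP: xab => /ltW -> /ltW ->.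
  by rewrite derive1E; have [_] := has_derive_within_interior xab (Ff x xab').
Qed.

Section DotvDerivative.
Context {R : realType} {n : nat}.
Implicit Types (f g p q : R -> 'rV[R]_n) (A : set R).

(** The product rule, from
    [f z * g z - f x * g x = (f z - f x) * g z + f x * (g z - g x)]. *)
Lemma dotv_derive_within A f g (x : R) (d e : 'rV[R]_n) :
  has_derive_within A f x d -> has_derive_within A g x e ->
  has_derive_within A (fun z => dotv (f z) (g z) : R^o) x
    (dotv d (g x) + dotv (f x) e).
Proof.
move=> fd ge.
have h : dotv ((z - x)^-1 *: (f z - f x)) (g z)
       + dotv (f x) ((z - x)^-1 *: (g z - g x))
    @[z --> within A x^'] --> dotv d (g x) + dotv (f x) e.
  apply: cvgD; apply: cvg_dotv => //; last exact: cvg_cst.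
  exact: cvg_dnbhs_within_derive ge.
apply: (cvg_trans _ h); apply: near_eq_cvg; near=> z.
rewrite dotvZl dotvZr -mulrDr dotvDl dotvDr dotvNl dotvNr.
by rewrite addrA subrK.
Unshelve. all: by end_near. Qed.

Lemma integral_dotv_derive p p' q q' (a b : R) : a < b ->
  (forall x, a <= x <= b -> has_derive_within `[a, b]%classic p x (p' x)) ->
  (forall x, a <= x <= b -> has_derive_within `[a, b]%classic q x (q' x)) ->
  {within `[a, b]%classic, continuous p'} ->
  {within `[a, b]%classic, continuous q'} ->
  (\int[@lebesgue_measure R]_(x in `[a, b])
     (dotv (p' x) (q x) + dotv (p x) (q' x))%:E
   = (dotv (p b) (q b) - dotv (p a) (q a))%:E)%E.
Proof.
move=> ab pp' qq' cp' cq'.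
have cwd f f' :
    (forall x, a <= x <= b -> has_derive_within `[a, b]%classic f x (f' x)) ->
    {within `[a, b]%classic, continuous f}.
  move=> ff'; apply/subspace_continuousP => x /=; rewrite in_itv /= => xab.
  exact: cvg_within_derive (ff' x xab).
apply: (@FTC_within R (fun x => dotv (p x) (q x))) => // [x xab|].
  by apply: dotv_derive_within; [exact: pp'|exact: qq'].
apply: within_continuousD; apply: within_continuous_dotv => //.
- exact: cwd qq'.
- exact: cwd pp'.
Qed.

(** Green's second identity on a segment: the integrand is the derivative of
    [dotv p q1 - dotv p1 q], which vanishes at both endpoints. *)
Lemma integral_green p p1 p2 q q1 q2 (a b : R) : a < b ->
  (forall x, a <= x <= b ->
     [/\ has_derive_within `[a, b]%classic p x (p1 x),
         has_derive_within `[a, b]%classic p1 x (p2 x),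
         has_derive_within `[a, b]%classic q x (q1 x) &
         has_derive_within `[a, b]%classic q1 x (q2 x)]) ->
  {within `[a, b]%classic, continuous p2} ->
  {within `[a, b]%classic, continuous q2} ->
  p a = 0 -> p b = 0 -> q a = 0 -> q b = 0 ->
  (\int[@lebesgue_measure R]_(x in `[a, b])
     (dotv (p x) (q2 x) - dotv (p2 x) (q x))%:E = 0)%E.
Proof.
move=> ab dpq cp2 cq2 pa pb qa qb.
have cwd f f' :
    (forall x, a <= x <= b -> has_derive_within `[a, b]%classic f x (f' x)) ->
    {within `[a, b]%classic, continuous f}.
  move=> ff'; apply/subspace_continuousP => x /=; rewrite in_itv /= => xab.
  exact: cvg_within_derive (ff' x xab).
rewrite (@FTC_within R (fun x => dotv (p x) (q1 x) - dotv (p1 x) (q x))) //.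
- by rewrite pa pb qa qb !dotv0l !dotv0r !subrr.
- move=> x xab; have [dp dp1 dq dq1] := dpq x xab.
  have := has_derive_withinB (dotv_derive_within dp dq1)
    (dotv_derive_within dp1 dq).
  by congr has_derive_within; ring.
- apply: within_continuousB; apply: within_continuous_dotv => //.
  + by apply: (cwd _ p1) => x /dpq[].
  + by apply: (cwd _ q1) => x /dpq[].
Qed.

End DotvDerivative.

(** * Borel measurability and Fubini's theorem on products *)

(** An open set of [R^3] is the union of the countably many balls with rational
    centre and radius that it contains, and such a ball, being a cube, is a
    product of intervals. *)
Lemma open_measurable3 (R : realType) (U : set (R * R * R)) :
  open U -> measurable (U : set (mspace3 R)).
Proof.
move=> oU.
pose c (q : rat * rat * rat * rat) : R * R * R :=
  (ratr q.1.1.1, ratr q.1.1.2, ratr q.1.2).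
pose F q : set (mspace3 R) :=
  if `[< ball (c q) (ratr q.2) `<=` U >] then ball (c q) (ratr q.2) else set0.
have mF q : measurable (F q).
  rewrite /F; case: ifP => // _.
  rewrite (_ : ball _ _ = (ball (c q).1.1 (ratr q.2) `*`
     ball (c q).1.2 (ratr q.2)) `*` ball (c q).2 (ratr q.2)).
    apply: measurableX; last exact: measurable_ball.
    by apply: measurableX; exact: measurable_ball.
  by [].
rewrite (_ : U = \bigcup_q F q).
  exact: countable_bigcupT_measurable.
apply/seteqP; split => [p Up|p [q _]]; last first.
  by rewrite /F; case: asboolP => // qU /qU.
have /nbhs_ballP[e /= e0 eU] : nbhs p U by apply: open_nbhs_nbhs.
(* Every point of a ball of radius [r] around a rational centre that is
   [r]-close to [p] lies within [r + r < e] of [p]. *)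
have [r /itvP rP] : exists r : rat, ratr r \in `]0, (e / 2)[.
  by apply: rat_in_itvoo; rewrite divr_gt0.
have r0 : (0:R) < ratr r by rewrite rP.
have approx (x : R) : exists s : rat, ball (ratr s : R) (ratr r) x.
  have [|s] := @rat_in_itvoo R (x - ratr r) (x + ratr r).
    by rewrite ltrD2l gtrN.
  rewrite in_itv /= => /andP[s1 s2]; exists s.
  by rewrite /ball /= ltr_norml; apply/andP; split; lra.
have [s1 h1] := approx p.1.1; have [s2 h2] := approx p.1.2.
have [s3 h3] := approx p.2.
exists ((s1, s2, s3), r) => //; rewrite /F /=.
have pc : ball (c (s1, s2, s3, r)) (ratr r : R) p by [].
rewrite ifT //; apply/asboolP => z cz; apply: eU.
have er : ratr r + ratr r <= e.
  by have : (ratr r : R) < e / 2 by [rewrite rP]; lra.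
exact: (le_ball er (ball_triangle (ball_sym pc) cz)).
Qed.

Lemma within_continuous_measurable3 (R : realType) (D : set (R * R * R))
    (f : R * R * R -> R) : measurable (D : set (mspace3 R)) ->
  {within D, continuous f} -> measurable_fun (D : set (mspace3 R)) f.
Proof.
move=> mD /continuousP cf; apply: (measurability _ (RGenOpens.measurableE R)).
move=> _ [_ [a [b ->] <-]].
have /open_subspaceP[V oV VE] :
    open (from_subspace D f @^-1` `]a, b[%classic).
  exact/cf/interval_open.
rewrite setIC -VE; apply: measurableI => //; exact: open_measurable3.
Qed.

Section ProductSigmaFinite.
Local Open Scope ereal_scope.
Context d1 d2 (T1 : measurableType d1) (T2 : measurableType d2) (R : realType).
Variable m1 : {sigma_finite_measure set T1 -> \bar R}.
Variable m2 : {sigma_finite_measure set T2 -> \bar R}.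

Lemma product_measure_sigma_finite : sigma_finite setT (m1 \x m2).
Proof.
have /sigma_finiteP[F [TF ndF Foo]] := sigma_finiteT m1.
have /sigma_finiteP[G [TG ndG Goo]] := sigma_finiteT m2.
exists (fun n => F n `*` G n).
  apply/seteqP; split => // -[x y] _.
  have [i _ Fix] : (\bigcup_k F k) x by rewrite -TF.
  have [j _ Gjy] : (\bigcup_k G k) y by rewrite -TG.
  exists (maxn i j) => //; split => /=.
  - by move: x Fix; exact/subsetPset/ndF/leq_maxl.
  - by move: y Gjy; exact/subsetPset/ndG/leq_maxr.
move=> k; have [? ?] := Foo k; have [? ?] := Goo k.
split; first exact: measurableX.
by rewrite [ltLHS]product_measure1E// lte_mul_pinfty// ge0_fin_numE.
Qed.

End ProductSigmaFinite.

Definition mspace2 (R : realType) :=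
  (measurableTypeR R * measurableTypeR R)%type.

(** A constant of its own, so that it can carry the sigma-finiteness that
    Fubini's theorem asks of the first factor of [mu3]. *)
Definition mu2 {R : realType} : set (mspace2 R) -> \bar R :=
  (@lebesgue_measure R \x @lebesgue_measure R)%E.

HB.instance Definition _ (R : realType) := Measure.on (@mu2 R).
HB.instance Definition _ (R : realType) :=
  Measure_isSigmaFinite.Build _ _ _ (@mu2 R)
    (@product_measure_sigma_finite _ _ (measurableTypeR R) (measurableTypeR R) R
      (@lebesgue_measure R) (@lebesgue_measure R)).

Lemma mu3E (R : realType) : @mu3 R = (@mu2 R \x @lebesgue_measure R)%E.
Proof. by []. Qed.

Section FubiniRectangle.
Local Open Scope ereal_scope.
Context d1 d2 (T1 : measurableType d1) (T2 : measurableType d2) (R : realType).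
Variable m1 : {sigma_finite_measure set T1 -> \bar R}.
Variable m2 : {sigma_finite_measure set T2 -> \bar R}.
Variables (A : set T1) (B : set T2) (f : T1 * T2 -> \bar R).
Hypothesis mA : measurable A.
Hypothesis mB : measurable B.
Hypothesis intf : (m1 \x m2).-integrable (A `*` B) f.

Let intfAB : (m1 \x m2).-integrable setT (f \_ (A `*` B)).
Proof. exact/(integrable_mkcond _ (measurableX mA mB)). Qed.

Lemma integral_setX1 :
  \int[m1 \x m2]_(p in A `*` B) f p =
  \int[m1]_(x in A) \int[m2]_(y in B) f (x, y).
Proof.
rewrite integral_mkcond -integral12_prod_meas1// [RHS]integral_mkcond.
apply: eq_integral => x _; rewrite /fubini_F patchE; case: ifPn => xA.
  rewrite [RHS]integral_mkcond; apply: eq_integral => y _.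
  by rewrite !patchE in_setX xA.
by apply: integral0_eq => y _; rewrite patchE in_setX (negbTE xA).
Qed.

Lemma integral_setX2 :
  \int[m1 \x m2]_(p in A `*` B) f p =
  \int[m2]_(y in B) \int[m1]_(x in A) f (x, y).
Proof.
rewrite integral_mkcond -integral21_prod_meas1// [RHS]integral_mkcond.
apply: eq_integral => y _; rewrite /fubini_G patchE; case: ifPn => yB.
  rewrite [RHS]integral_mkcond; apply: eq_integral => x _.
  by rewrite !patchE in_setX yB andbT.
by apply: integral0_eq => x _; rewrite patchE in_setX (negbTE yB) andbF.
Qed.

End FubiniRectangle.

(** * Integrals over boxes *)

(** The cylinder shortened at both time ends: a compact set, on which the
    derivatives of a classical solution are bounded. *)
Definition box (R : realType) (L S a b : R) : set (R * R * R) :=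
  rect L S `*` `[a, b]%classic.

Section Box.
Context {R : realType} (L S : R).
Implicit Types (a b t : R) (f : R * R * R -> R).

Lemma measurable_rect : measurable (rect L S : set (mspace2 R)).
Proof. by apply: measurableX; exact: measurable_itv. Qed.

Lemma measurable_box a b : measurable (box L S a b : set (mspace3 R)).
Proof.
by apply: measurableX; [exact: measurable_rect|exact: measurable_itv].
Qed.

Lemma lebesgue_itv_lty a b : (@lebesgue_measure R `[a, b]%classic < +oo)%E.
Proof. by rewrite lebesgue_measure_itv/=; case: ifP; rewrite -?EFinB ltry. Qed.

Lemma mu2_rect_lty : (@mu2 R (rect L S) < +oo)%E.
Proof.
rewrite /mu2 [ltLHS]product_measure1E; [|exact: measurable_itv..].
apply: lte_mul_pinfty => //; last exact: lebesgue_itv_lty.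
by rewrite ge0_fin_numE//; exact: lebesgue_itv_lty.
Qed.

Lemma mu3_box_lty a b : (@mu3 R (box L S a b) < +oo)%E.
Proof.
rewrite /mu3 [ltLHS]product_measure1E;
  [|exact: measurable_rect|exact: measurable_itv].
apply: lte_mul_pinfty => //; last exact: lebesgue_itv_lty.
by rewrite ge0_fin_numE//; exact: mu2_rect_lty.
Qed.

Lemma compact_box a b : compact (box L S a b).
Proof.
apply: compact_setX; last exact: segment_compact.
by apply: compact_setX; exact: segment_compact.
Qed.

Lemma bounded_box a b f : {within box L S a b, continuous f} ->
  [bounded f p | p in box L S a b].
Proof.
move=> cf.
have /compact_bounded[M [_ mrt]] := continuous_compact cf (@compact_box a b).
exists M; split; rewrite ?num_real // => r Mr z bz.
by apply: (mrt r Mr); exists z.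
Qed.

Lemma integrable_box a b f : {within box L S a b, continuous f} ->
  (@mu3 R).-integrable (box L S a b) (fun p => (f p)%:E).
Proof.
move=> cf; apply: measurable_bounded_integrable.
- exact: measurable_box.
- exact: mu3_box_lty.
- by apply: within_continuous_measurable3 cf; exact: measurable_box.
- exact: bounded_box.
Qed.

Lemma measurable_box_slice a b t f : {within box L S a b, continuous f} ->
  a <= t <= b ->
  measurable_fun (rect L S : set (mspace2 R)) (fun p => f (p, t)).
Proof.
move=> cf tab.
have mf := within_continuous_measurable3 (measurable_box a b) cf.
have := measurable_funTS (D := rect L S : set (mspace2 R)) (measurableT_comp
 ((measurable_restrictT _ (measurable_box a b)).1 mf)
 (@pair2_measurable _ _ (mspace2 R) (measurableTypeR R) t)).
apply: eq_measurable_fun => p prect /=; rewrite patchE ifT //.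
by rewrite in_setX prect /= inE /= in_itv.
Qed.

Lemma integrable_box_slice a b t f : {within box L S a b, continuous f} ->
  a <= t <= b -> (@mu2 R).-integrable (rect L S) (fun p => (f (p, t))%:E).
Proof.
move=> cf tab; apply: (@measurable_bounded_integrable _ (mspace2 R)).
- exact: measurable_rect.
- exact: mu2_rect_lty.
- exact: measurable_box_slice cf tab.
- have [M [Mr MP]] := bounded_box cf; exists M; split => // r Mlt p prect.
  by apply: MP => //; split => //=; rewrite in_itv.
Qed.

Lemma integral_box_t a b f : {within box L S a b, continuous f} ->
  (\int[@mu3 R]_(p in box L S a b) (f p)%:E =
   \int[@mu2 R]_(p in rect L S)
     \int[@lebesgue_measure R]_(t in `[a, b]) (f (p, t))%:E)%E.
Proof.
move=> cf; rewrite mu3E integral_setX1; [by []|exact: measurable_rect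
  |exact: measurable_itv|exact: integrable_box].
Qed.

(** Only the space integral in one variable has to vanish: Fubini's theorem is
    used to integrate in that variable first. *)
Lemma integral_box_x0 a b f : {within box L S a b, continuous f} ->
  (forall y t, 0 <= y <= S -> a <= t <= b ->
    (\int[@lebesgue_measure R]_(x in `[0%R, L]) (f (x, y, t))%:E = 0)%E) ->
  (\int[@mu3 R]_(p in box L S a b) (f p)%:E = 0)%E.
Proof.
move=> cf f0; rewrite mu3E integral_setX2; [|exact: measurable_rect
  |exact: measurable_itv|exact: integrable_box].
apply: integral0_eq => t; rewrite /= in_itv /= => tab.
rewrite /mu2 integral_setX2; [|exact: measurable_itv|exact: measurable_itv
  |exact: integrable_box_slice cf tab].
by apply: integral0_eq => y; rewrite /= in_itv /= => yS; exact: f0.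
Qed.

Lemma integral_box_y0 a b f : {within box L S a b, continuous f} ->
  (forall x t, 0 <= x <= L -> a <= t <= b ->
    (\int[@lebesgue_measure R]_(y in `[0%R, S]) (f (x, y, t))%:E = 0)%E) ->
  (\int[@mu3 R]_(p in box L S a b) (f p)%:E = 0)%E.
Proof.
move=> cf f0; rewrite mu3E integral_setX2; [|exact: measurable_rect
  |exact: measurable_itv|exact: integrable_box].
apply: integral0_eq => t; rewrite /= in_itv /= => tab.
rewrite /mu2 integral_setX1; [|exact: measurable_itv|exact: measurable_itv
  |exact: integrable_box_slice cf tab].
by apply: integral0_eq => x; rewrite /= in_itv /= => xL; exact: f0.
Qed.

End Box.

(** * Green's formula for the heat operator *)

Lemma within_continuous_slice (X Y Z : topologicalType) (A : set X) (B : set Y)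
    (g : X -> Y) (f : Y -> Z) : continuous g -> (forall x, A x -> B (g x)) ->
  {within B, continuous f} -> {within A, continuous (fun x => f (g x))}.
Proof.
move=> cg AB /subspace_continuousP cf; apply/subspace_continuousP => x Ax.
apply: (cvg_comp _ _ _ (cf _ (AB _ Ax))) => U BU.
by have := cg x _ BU; rewrite /nbhs /=; apply: filterS => z gz /AB.
Qed.

Lemma continuous_pairl (X Y : topologicalType) (y : Y) :
  continuous (fun x : X => (x, y)).
Proof.
move=> x; apply: (@cvg_pair _ _ _ (nbhs x) (nbhs x) (nbhs y)).
  exact: cvg_id.
exact: cvg_cst.
Qed.

Lemma continuous_pairr (X Y : topologicalType) (x : X) :
  continuous (fun y : Y => (x, y)).
Proof.
move=> y; apply: (@cvg_pair _ _ _ (nbhs y) (nbhs x) (nbhs y)).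
  exact: cvg_cst.
exact: cvg_id.
Qed.

(** A function of (x, y, t) together with its partial derivatives, carried as
    data: [dx L (v - u)] is [dx L v - dx L u] on the cylinder only, so a
    difference of solutions is handled through the differences of the
    derivatives and never differentiated itself. *)
Record jet (R : realType) (n : nat) := Jet {
  jet0 : R -> R -> R -> 'rV[R]_n;
  jetx : R -> R -> R -> 'rV[R]_n;
  jety : R -> R -> R -> 'rV[R]_n;
  jett : R -> R -> R -> 'rV[R]_n;
  jetxx : R -> R -> R -> 'rV[R]_n;
  jetyy : R -> R -> R -> 'rV[R]_n }.

Section Jets.
Context {R : realType} {n : nat} (L S T : R).
Implicit Types (u : R -> R -> R -> 'rV[R]_n) (p q : jet R n).

Definition jet_of u : jet R n :=
  Jet u (dx L u) (dy S u) (dt u) (dx L (dx L u)) (dy S (dy S u)).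

Definition jetB p q : jet R n :=
  Jet (fun x y t => jet0 p x y t - jet0 q x y t)
      (fun x y t => jetx p x y t - jetx q x y t)
      (fun x y t => jety p x y t - jety q x y t)
      (fun x y t => jett p x y t - jett q x y t)
      (fun x y t => jetxx p x y t - jetxx q x y t)
      (fun x y t => jetyy p x y t - jetyy q x y t).

Definition C21_jet p : Prop :=
  [/\ forall x y t, cyl L S T (x, y, t) ->
        [/\ has_derive_within `[0, L]%classic (fun z => jet0 p z y t) x
              (jetx p x y t),
            has_derive_within `[0, S]%classic (fun z => jet0 p x z t) y
              (jety p x y t),
            forall A, has_derive_within A (jet0 p x y) t (jett p x y t),
            has_derive_within `[0, L]%classic (fun z => jetx p z y t) x
              (jetxx p x y t) &
            has_derive_within `[0, S]%classic (fun z => jety p x z t) y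
              (jetyy p x y t)],
      {within cyl L S T, continuous (unc (jet0 p))},
      {within cyl L S T, continuous (unc (jett p))},
      {within cyl L S T, continuous (unc (jetxx p))} &
      {within cyl L S T, continuous (unc (jetyy p))}].

Lemma C21_jet_of u : C21 L S T u -> C21_jet (jet_of u).
Proof.
move=> [du cu cut _ [cuxx cuyy]].
split; [|exact: cu|exact: cut|exact: cuxx|exact: cuyy].
move=> x y t /du[ux uy ut uxx uyy].
split; [exact: ux|exact: uy| |exact: uxx|exact: uyy].
by move=> A; exact: (@derivable_has_derive_within _ _ A (u x y) t ut).
Qed.

Lemma C21_jetB p q : C21_jet p -> C21_jet q -> C21_jet (jetB p q).
Proof.
move=> [dp p0 pt pxx pyy] [dq q0 qt qxx qyy].
split.
- move=> x y t c; have [px py pt' px' py'] := dp x y t c.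
  have [qx qy qt' qx' qy'] := dq x y t c.
  split; [exact: (has_derive_withinB px qx)|exact: (has_derive_withinB py qy)
    | |exact: (has_derive_withinB px' qx')|exact: (has_derive_withinB py' qy')].
  by move=> A; exact: (has_derive_withinB (pt' A) (qt' A)).
- exact: (within_continuousB p0 q0).
- exact: (within_continuousB pt qt).
- exact: (within_continuousB pxx qxx).
- exact: (within_continuousB pyy qyy).
Qed.

(** With [P = d/dt - Laplacian] and its formal adjoint
    [P* = - d/dt - Laplacian], this is [<P p, q> - <p, P* q>]. *)
Definition green_density p q (z : R * R * R) : R :=
  dotv (unc (jett p) z - (unc (jetxx p) z + unc (jetyy p) z)) (unc (jet0 q) z)
  - dotv (unc (jet0 p) z)
      (- unc (jett q) z - (unc (jetxx q) z + unc (jetyy q) z)).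

Lemma within_continuous_green p q : C21_jet p -> C21_jet q ->
  {within cyl L S T, continuous (green_density p q)}.
Proof.
move=> [_ p0 pt pxx pyy] [_ q0 qt qxx qyy].
have pL := within_continuousB pt (within_continuousD pxx pyy).
have qN : {within cyl L S T, continuous (- unc (jett q))}.
  by move=> z; apply: cvgN; exact: qt.
have qL := within_continuousB qN (within_continuousD qxx qyy).
exact: (within_continuousB (within_continuous_dotv pL q0)
  (within_continuous_dotv p0 qL)).
Qed.

Definition lateral_zero u := forall t, 0 < t < T ->
  (forall x, 0 <= x <= L -> u x 0 t = 0 /\ u x S t = 0) /\
  (forall y, 0 <= y <= S -> u 0 y t = 0 /\ u L y t = 0).

(** Green's formula for [P].  The density is the sum of three exact derivatives:
    [d/dt <p, q>], and [d/dx (<p, q_x> - <p_x, q>)] with its analogue in y.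
    The last two integrate to zero because [p] and [q] vanish on the lateral
    boundary, and the first gives the values at the two time ends. *)
Lemma green_box p q a b : 0 < L -> 0 < S -> 0 < a -> a < b -> b < T ->
  C21_jet p -> C21_jet q -> lateral_zero (jet0 p) -> lateral_zero (jet0 q) ->
  (\int[@mu3 R]_(z in box L S a b) (green_density p q z)%:E =
   \int[@mu2 R]_(z in rect L S)
     (dotv (jet0 p z.1 z.2 b) (jet0 q z.1 z.2 b)
      - dotv (jet0 p z.1 z.2 a) (jet0 q z.1 z.2 a))%:E)%E.
Proof.
move=> L0 S0 a0 ab bT Cp Cq pz qz.
have [dp p0 pt pxx pyy] := Cp; have [dq q0 qt qxx qyy] := Cq.
have tT t : a <= t <= b -> 0 < t < T.
  by move=> /andP[? ?]; apply/andP; split; lra.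
have box_cyl : box L S a b `<=` cyl L S T.
  move=> z [zr /=]; rewrite in_itv /= => /tT zt.
  by split => //=; rewrite in_itv.
have cylP x y t : 0 <= x <= L -> 0 <= y <= S -> a <= t <= b ->
    cyl L S T (x, y, t).
  move=> xL yS tab; apply: box_cyl; split; last by rewrite /= in_itv.
  by split; rewrite /= in_itv.
pose ht z := dotv (unc (jett p) z) (unc (jet0 q) z)
           + dotv (unc (jet0 p) z) (unc (jett q) z).
pose hx z := dotv (unc (jet0 p) z) (unc (jetxx q) z)
           - dotv (unc (jetxx p) z) (unc (jet0 q) z).
pose hy z := dotv (unc (jet0 p) z) (unc (jetyy q) z)
           - dotv (unc (jetyy p) z) (unc (jet0 q) z).
have cht : {within box L S a b, continuous ht}.
  apply: continuous_subspaceW box_cyl _.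
  exact: (within_continuousD (within_continuous_dotv pt q0)
    (within_continuous_dotv p0 qt)).
have chx : {within box L S a b, continuous hx}.
  apply: continuous_subspaceW box_cyl _.
  exact: (within_continuousB (within_continuous_dotv p0 qxx)
    (within_continuous_dotv pxx q0)).
have chy : {within box L S a b, continuous hy}.
  apply: continuous_subspaceW box_cyl _.
  exact: (within_continuousB (within_continuous_dotv p0 qyy)
    (within_continuous_dotv pyy q0)).
have cx (f : R -> R -> R -> 'rV[R]_n) y t : 0 <= y <= S -> a <= t <= b ->
    {within cyl L S T, continuous (unc f)} ->
    {within `[0, L]%classic, continuous (fun x => f x y t)}.
  move=> yS tab cf.
  apply: (within_continuous_slice (g := fun x => (x, y, t)) _ _ cf).
    move=> x; exact: (continuous_comp (@continuous_pairl R R y x)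
      (@continuous_pairl (R * R)%type R t (x, y))).
  by move=> x /=; rewrite in_itv /= => xL; exact: cylP.
have cy (f : R -> R -> R -> 'rV[R]_n) x t : 0 <= x <= L -> a <= t <= b ->
    {within cyl L S T, continuous (unc f)} ->
    {within `[0, S]%classic, continuous (fun y => f x y t)}.
  move=> xL tab cf.
  apply: (within_continuous_slice (g := fun y => (x, y, t)) _ _ cf).
    move=> y; exact: (continuous_comp (@continuous_pairr R R x y)
      (@continuous_pairl (R * R)%type R t (x, y))).
  by move=> y /=; rewrite in_itv /= => yS; exact: cylP.
have ct (f : R -> R -> R -> 'rV[R]_n) x y : 0 <= x <= L -> 0 <= y <= S ->
    {within cyl L S T, continuous (unc f)} ->
    {within `[a, b]%classic, continuous (f x y)}.
  move=> xL yS cf.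
  apply: (within_continuous_slice (g := fun t => (x, y, t)) _ _ cf).
    exact: (@continuous_pairr (R * R)%type R (x, y)).
  by move=> t /=; rewrite in_itv /= => tab; exact: cylP.
have -> : (fun z => (green_density p q z)%:E) =
    ((fun z => (ht z)%:E) \+ ((fun z => (hx z)%:E) \+ (fun z => (hy z)%:E)))%E.
  apply/funext => z /=; rewrite -!EFinD; congr EFin.
  rewrite /green_density /ht /hx /hy !(dotvDl, dotvDr, dotvNl, dotvNr); ring.
rewrite integralD; [|exact: measurable_box|exact: integrable_box|]; last first.
  by apply: integrableD; [exact: measurable_box|exact: integrable_box..].
rewrite integralD; [|exact: measurable_box|exact: integrable_box..].
rewrite [X in (_ + (X + _))%E]integral_box_x0; [|exact: chx|]; last first.
  move=> y t yS tab.
  apply: (@integral_green _ _ (fun x => jet0 p x y t) (fun x => jetx p x y t)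
    (fun x => jetxx p x y t) (fun x => jet0 q x y t) (fun x => jetx q x y t)
    (fun x => jetxx q x y t)); first exact: L0.
  - move=> x xL; have [px py _ px' py'] := dp _ _ _ (cylP _ _ _ xL yS tab).
    have [qx qy _ qx' qy'] := dq _ _ _ (cylP _ _ _ xL yS tab).
    by split; [exact: px|exact: px'|exact: qx|exact: qx'].
  - exact: (cx _ _ _ yS tab pxx).
  - exact: (cx _ _ _ yS tab qxx).
  - exact: (((pz t (tT t tab)).2 y yS).1).
  - exact: (((pz t (tT t tab)).2 y yS).2).
  - exact: (((qz t (tT t tab)).2 y yS).1).
  - exact: (((qz t (tT t tab)).2 y yS).2).
rewrite [X in (_ + (_ + X))%E]integral_box_y0; [|exact: chy|]; last first.
  move=> x t xL tab.
  apply: (@integral_green _ _ (fun y => jet0 p x y t) (fun y => jety p x y t)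
    (fun y => jetyy p x y t) (fun y => jet0 q x y t) (fun y => jety q x y t)
    (fun y => jetyy q x y t)); first exact: S0.
  - move=> y yS; have [px py _ px' py'] := dp _ _ _ (cylP _ _ _ xL yS tab).
    have [qx qy _ qx' qy'] := dq _ _ _ (cylP _ _ _ xL yS tab).
    by split; [exact: py|exact: py'|exact: qy|exact: qy'].
  - exact: (cy _ _ _ xL tab pyy).
  - exact: (cy _ _ _ xL tab qyy).
  - exact: (((pz t (tT t tab)).1 x xL).1).
  - exact: (((pz t (tT t tab)).1 x xL).2).
  - exact: (((qz t (tT t tab)).1 x xL).1).
  - exact: (((qz t (tT t tab)).1 x xL).2).
rewrite !adde0 integral_box_t; last exact: cht.
apply: eq_integral => -[x y]; rewrite inE => -[/=]; rewrite !in_itv /= => xL yS.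
apply: (@integral_dotv_derive _ _ (jet0 p x y) (jett p x y) (jet0 q x y)
  (jett q x y)); first exact: ab.
- by move=> t tab; have [_ _ + _ _] := dp _ _ _ (cylP _ _ _ xL yS tab); exact.
- by move=> t tab; have [_ _ + _ _] := dq _ _ _ (cylP _ _ _ xL yS tab); exact.
- exact: (ct _ _ _ xL yS pt).
- exact: (ct _ _ _ xL yS qt).
Qed.

End Jets.

(** * Comparison of possibly infinite integrals *)

Section IntegralComparison.
Local Open Scope ereal_scope.
Context d (X : measurableType d) (R : realType).
Variable mu : {measure set X -> \bar R}.
Implicit Types (U V : X -> \bar R).

(** The inequality [a + r <= b] with positive and negative parts moved so that
    all terms are nonnegative: it can then be integrated when some of the
    integrals are infinite. *)
Lemma maxe_balance (a b : \bar R) (r : R) : a + r%:E <= b ->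
  maxe a 0 + (maxe (- b) 0 + maxe r%:E 0)
  <= maxe b 0 + (maxe (- a) 0 + maxe (- r%:E) 0).
Proof.
have maxrE (x : R) : (Num.max x 0 = x + Num.max (- x) 0)%R.
  have [x0|/ltW x0] := lerP x 0%R.
  - by rewrite max_l ?oppr_ge0// subrr.
  - by rewrite max_r ?oppr_le0// addr0.
move: a b => [a| |] [b| |] //=.
- rewrite -?EFinN -!EFin_max -!EFinD !lee_fin.
  by rewrite (maxrE a) (maxrE b) (maxrE r); lra.
all: rewrite ?maxye ?maxNye ?maxey ?maxeNy //= ?oppeK.
all: by move=> _; rewrite -?EFin_max //= leey.
Qed.

Lemma leeB_balance (a c p m u v u' v' : \bar R) :
  a + (c + p) <= v + (u + m) -> p \is a fin_num -> m \is a fin_num ->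
  v <= v' -> u <= u' -> a + (c + (p - m)) <= v' + u'.
Proof.
move=> le pfin mfin vv' uu'; rewrite !addeA leeBlDr// -!addeA.
by apply: (le_trans le); rewrite leeD// leeD2r.
Qed.

Lemma leeBB_balance (a c u v : \bar R) : 0 <= a -> 0 <= c ->
  v \is a fin_num -> u \is a fin_num -> a + c <= v + u -> a - u <= v - c.
Proof.
move: a c u v => [a| |] [c| |] [u| |] [v| |] //= _ _ _ _.
by rewrite -!EFinD !lee_fin; lra.
Qed.

(** [U] and [V] need not be integrable, so [U + h <= V] cannot be integrated and
    rearranged directly.  If [int V^+] or [int U^-] is infinite, the inequality
    between the integrals is immediate.  Otherwise the balanced form of
    [U + h <= V] gives
    [int_Dk U^+ + int_Dk V^- + int_Dk h <= int V^+ + int U^-], and monotone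
    convergence on the left finishes the proof. *)
Lemma le_integral_exhaustion (D : (set X)^nat) U V (h : X -> R) :
  nondecreasing_seq D -> (forall k, measurable (D k)) ->
  measurable_fun (\bigcup_k D k) U -> measurable_fun (\bigcup_k D k) V ->
  \int[mu]_(x in \bigcup_k D k) U^\+ x < +oo \/
    \int[mu]_(x in \bigcup_k D k) U^\- x < +oo ->
  \int[mu]_(x in \bigcup_k D k) V^\+ x < +oo \/
    \int[mu]_(x in \bigcup_k D k) V^\- x < +oo ->
  (forall k, mu.-integrable (D k) (EFin \o h)) ->
  (forall x, (\bigcup_k D k) x -> U x + (h x)%:E <= V x) ->
  \int[mu]_(x in D k) (h x)%:E @[k --> \oo] --> 0 ->
  \int[mu]_(x in \bigcup_k D k) U x <= \int[mu]_(x in \bigcup_k D k) V x.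
Proof.
set E := \bigcup_k D k => ndD mD mU mV qU qV ih UhV h0.
have DE k : D k `<=` E by move=> x Dx; exists k.
have mE : measurable E by exact: bigcup_measurable.
have cvgD (f : X -> \bar R) : measurable_fun E f -> (forall x, 0 <= f x) ->
    \int[mu]_(x in D k) f x @[k --> \oo] --> \int[mu]_(x in E) f x.
  move=> mf f0; apply: ge0_nondecreasing_set_cvg_integral => //.
  by move=> k; apply: measurable_funS (mf).
have leD (f : X -> \bar R) k : measurable_fun E f -> (forall x, 0 <= f x) ->
    \int[mu]_(x in D k) f x <= \int[mu]_(x in E) f x.
  by move=> mf f0; apply: ge0_subset_integral.
have mUp : measurable_fun E U^\+ by exact: measurable_funepos.
have mUn : measurable_fun E U^\- by exact: measurable_funeneg.
have mVp : measurable_fun E V^\+ by exact: measurable_funepos.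
have mVn : measurable_fun E V^\- by exact: measurable_funeneg.
have Up0 : 0 <= \int[mu]_(x in E) U^\+ x by exact: integral_ge0.
have Un0 : 0 <= \int[mu]_(x in E) U^\- x by exact: integral_ge0.
have Vp0 : 0 <= \int[mu]_(x in E) V^\+ x by exact: integral_ge0.
have Vn0 : 0 <= \int[mu]_(x in E) V^\- x by exact: integral_ge0.
rewrite [leLHS]integralE [leRHS]integralE.
have [Vpoo|Vpoo] := eqVneq (\int[mu]_(x in E) V^\+ x) +oo.
  case: qV; first by rewrite Vpoo ltxx.
  by move=> Vnfin; rewrite Vpoo addye ?leey// eqe_oppLR /= lt_eqF.
have [Unoo|Unoo] := eqVneq (\int[mu]_(x in E) U^\- x) +oo.
  case: qU; last by rewrite Unoo ltxx.
  by move=> Upfin; rewrite Unoo /= addeNy leNye.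
pose hE := EFin \o h.
have step k : \int[mu]_(x in D k) U^\+ x +
    (\int[mu]_(x in D k) V^\- x + \int[mu]_(x in D k) (h x)%:E)
    <= \int[mu]_(x in E) V^\+ x + \int[mu]_(x in E) U^\- x.
  have mhk := measurable_int _ (ih k).
  have mhp : measurable_fun (D k) hE^\+ by exact: measurable_funepos.
  have mhn : measurable_fun (D k) hE^\- by exact: measurable_funeneg.
  have mUpk : measurable_fun (D k) U^\+ by apply: measurable_funS (mUp).
  have mUnk : measurable_fun (D k) U^\- by apply: measurable_funS (mUn).
  have mVpk : measurable_fun (D k) V^\+ by apply: measurable_funS (mVp).
  have mVnk : measurable_fun (D k) V^\- by apply: measurable_funS (mVn).
  have : \int[mu]_(x in D k) (U^\+ x + (V^\- x + hE^\+ x))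
      <= \int[mu]_(x in D k) (V^\+ x + (U^\- x + hE^\- x)).
    apply: ge0_le_integral => //.
    - by move=> x _; rewrite !adde_ge0.
    - by apply: emeasurable_funD => //; exact: emeasurable_funD.
    - by apply: emeasurable_funD => //; exact: emeasurable_funD.
    - move=> x Dx; rewrite !funeposE !funenegE.
      exact: (maxe_balance (UhV x (DE k x Dx))).
  rewrite !ge0_integralD //; last 4 first.
  - by move=> x _; rewrite adde_ge0.
  - exact: emeasurable_funD.
  - by move=> x _; rewrite adde_ge0.
  - exact: emeasurable_funD.
  have hpfin := integrable_pos_fin_num (mD k) (ih k).
  have hnfin := integrable_neg_fin_num (mD k) (ih k).
  have -> : \int[mu]_(x in D k) (h x)%:E =
      \int[mu]_(x in D k) hE^\+ x - \int[mu]_(x in D k) hE^\- x.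
    by rewrite -integralE.
  move=> ineq.
  exact: (leeB_balance ineq hpfin hnfin (leD _ _ mVp _) (leD _ _ mUn _)).
have lim : \int[mu]_(x in D k) U^\+ x +
    (\int[mu]_(x in D k) V^\- x + \int[mu]_(x in D k) (h x)%:E) @[k --> \oo]
    --> \int[mu]_(x in E) U^\+ x + (\int[mu]_(x in E) V^\- x + 0).
  apply: cvgeD; first by rewrite adde0 ge0_adde_def// inE.
    exact: cvgD.
  by apply: cvgeD; [rewrite fin_num_adde_defl|exact: cvgD|exact: h0].
have : \int[mu]_(x in E) U^\+ x + (\int[mu]_(x in E) V^\- x + 0)
    <= \int[mu]_(x in E) V^\+ x + \int[mu]_(x in E) U^\- x.
  rewrite -(cvg_lim _ lim)//; apply: lime_le.
    by apply/cvg_ex; eexists; exact: lim.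
  by near=> k; exact: step.
rewrite adde0; apply: leeBB_balance => //.
- by rewrite ge0_fin_numE// lt_neqAle Vpoo leey.
- by rewrite ge0_fin_numE// lt_neqAle Unoo leey.
Unshelve. all: by end_near. Qed.

End IntegralComparison.

(** * The terms at the time ends *)

Section Limits.
Context {R : realType}.

Lemma cvg_seq_within (X Y : topologicalType) (A : set X) (f : X -> Y)
    (s : nat -> X) (x : X) : {within A, continuous f} -> A x ->
  (forall k, A (s k)) -> s @ \oo --> x -> f (s k) @[k --> \oo] --> f x.
Proof.
move=> /subspace_continuousP cf Ax As sx.
apply: (cvg_comp _ _ _ (cf x Ax)) => U AU.
have := sx _ AU; rewrite /nbhs /=; apply: filterS => k; exact.
Qed.

Lemma cvg_integral_rect0 (L S M : R) (f : nat -> R * R -> R) :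
  (forall k, measurable_fun (rect L S : set (mspace2 R)) (f k)) ->
  (forall k p, rect L S p -> `|f k p| <= M) ->
  (forall p, rect L S p -> f k p @[k --> \oo] --> 0) ->
  (\int[@mu2 R]_(p in rect L S) (f k p)%:E @[k --> \oo] --> 0)%E.
Proof.
move=> mf fM f0.
have [] := @dominated_convergence _ (mspace2 R) R (@mu2 R) (rect L S)
  (measurable_rect L S) (fun k p => (f k p)%:E) (cst 0%E) (cst M%:E).
- by move=> k; apply/measurable_EFinP; exact: mf.
- exact: measurable_cst.
- by apply: aeW => p prect; apply: cvg_EFin; [near=> k|exact: f0].
- apply: (@measurable_bounded_integrable _ (mspace2 R) R (@mu2 R) (cst M)).
  + exact: measurable_rect.
  + exact: mu2_rect_lty.
  + exact: measurable_cst.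
  + by exists `|M|; split=> // r Mr p _; exact: ltW.
- by apply: aeW => p k prect; rewrite lee_fin; exact: fM.
by move=> _ _; rewrite integral0.
Unshelve. all: by end_near. Qed.

Lemma cvg_dotv0 n (f g : nat -> 'rV[R]_n) (M : R) :
  f @ \oo --> (0 : 'rV[R]_n) -> (forall k, `|g k| <= M) ->
  dotv (f k) (g k) @[k --> \oo] --> 0.
Proof.
move=> f0 gM; apply: norm_cvg0.
apply: (@squeeze_cvgr _ _ _ _ (cst 0) (fun k => n%:R * (`|f k| * M))).
- near=> k; rewrite normr_ge0 /=; apply: (le_trans (dotv_le _ _)).
  by rewrite ler_wpM2l// ler_wpM2l.
- exact: cvg_cst.
- rewrite -(mulr0 n%:R); apply: cvgMl_tmp; rewrite -(mul0r M); apply: cvgMr_tmp.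
  by rewrite -(normr0 'rV[R]_n); exact: cvg_norm.
Unshelve. all: by end_near. Qed.

End Limits.

(** The denominator starts at 3 so that [margin T k < T - margin T k] for all
    [k]. *)
Definition margin {R : realType} (T : R) (k : nat) : R := T / k.+3%:R.

Section Margin.
Context {R : realType} (T : R) (T_gt0 : 0 < T).

Lemma margin_gt0 k : 0 < margin T k.
Proof. by rewrite divr_gt0. Qed.

Lemma margin_lt k : margin T k < T - margin T k.
Proof.
have : margin T k <= T / 3%:R by rewrite ler_pM2l// lef_pV2 ?posrE// ler_nat.
by move: T_gt0 => ? ?; lra.
Qed.

Lemma margin_nincr j k : (j <= k)%N -> margin T k <= margin T j.
Proof. by move=> jk; rewrite ler_pM2l // lef_pV2 ?posrE // ler_nat !ltnS. Qed.

Lemma cvg_margin : margin T @ \oo --> 0.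
Proof.
rewrite -(mulr0 T); apply: cvgMl_tmp.
have := @cvg_harmonic R; rewrite -(cvg_shiftn 2).
by under eq_fun do rewrite addn2.
Qed.

Lemma bigcup_box_cyl (L S : R) :
  \bigcup_k box L S (margin T k) (T - margin T k) = cyl L S T.
Proof.
apply/seteqP; split => [[[x y] t] [k _ [xy /=]]|[[x y] t] [xy /=]].
  rewrite in_itv /= => /andP[mt tm]; split => //=; rewrite in_itv /=.
  by have m0 := margin_gt0 k; apply/andP; split; lra.
rewrite in_itv /= => /andP[t0 tT].
have r0 : 0 < Num.min t (T - t) by rewrite lt_min t0 subr_gt0.
have /cvgrPdist_lt/(_ _ r0)[k _ /(_ k (leqnn k))] := cvg_margin.
rewrite /= sub0r normrN gtr0_norm ?margin_gt0// lt_min => /andP[kt kT].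
by exists k => //; split => //=; rewrite in_itv /=; apply/andP; split; lra.
Qed.

Lemma nondecreasing_box_margin (L S : R) :
  nondecreasing_seq (fun k => box L S (margin T k) (T - margin T k)).
Proof.
move=> j k /margin_nincr jk; apply/subsetPset => -[[x y] t] [xy /=].
rewrite in_itv /= => /andP[h1 h2]; split => //=; rewrite in_itv /=.
by apply/andP; split; lra.
Qed.

Lemma margin_itv k : 0 < margin T k < T.
Proof.
by have := margin_gt0 k; have := margin_lt k; move=> *; apply/andP; split; lra.
Qed.

Lemma margin_itvC k : 0 < T - margin T k < T.
Proof.
by have := margin_gt0 k; have := margin_lt k; move=> *; apply/andP; split; lra.
Qed.

Lemma cvg_marginC : (T - margin T k) @[k --> \oo] --> T.
Proof.
rewrite -[X in _ --> X]subr0; apply: cvgB; [exact: cvg_cst|exact: cvg_margin].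
Qed.

End Margin.

Section Comparison.
Context {R : realType} {n : nat} (L S T : R).
Hypotheses (L_gt0 : 0 < L) (S_gt0 : 0 < S) (T_gt0 : 0 < T).
Implicit Types (u v us : R -> R -> R -> 'rV[R]_n).

Lemma bounded_cyl_ex u : [bounded unc u p | p in cyl L S T] ->
  exists2 M, 0 <= M &
    forall x y t, rect L S (x, y) -> 0 < t < T -> `|u x y t| <= M.
Proof.
move=> [M [_ HM]]; exists (`|M| + 1); first by rewrite addr_ge0.
move=> x y t xy tT; apply: (HM (`|M| + 1) _ (x, y, t)).
  by apply: (le_lt_trans (ler_norm M)); rewrite ltrDl.
by split => //=; rewrite in_itv.
Qed.

Lemma cvg_time_slice (A : set R) u x y (s : nat -> R) (t : R) :
  {within rect L S `*` A, continuous (unc u)} -> rect L S (x, y) -> A t ->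
  (forall k, A (s k)) -> s @ \oo --> t -> u x y (s k) @[k --> \oo] --> u x y t.
Proof.
move=> cu xy At As st; apply: (cvg_seq_within (A := A) _ At As st).
apply: (within_continuous_slice (g := fun t => (x, y, t)) _ _ cu).
  exact: (@continuous_pairr (R * R)%type R (x, y)).
by move=> z Az; split.
Qed.

(** By Green's formula the integral is a difference of integrals of
    [<v - u, us>] over the rectangle at times close to T and to 0.  Near T the
    factor [us] tends to 0 pointwise, near 0 the factor [v - u] does, and the
    other factor is bounded: dominated convergence applies. *)
Lemma cvg_integral_green u v us :
  C21 L S T u -> C21 L S T v -> C21 L S T us ->
  {within rect L S `*` `[0, T[%classic, continuous (unc u)} ->
  {within rect L S `*` `[0, T[%classic, continuous (unc v)} ->
  {within rect L S `*` `]0, T]%classic, continuous (unc us)} ->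
  [bounded unc u p | p in cyl L S T] ->
  [bounded unc v p | p in cyl L S T] ->
  [bounded unc us p | p in cyl L S T] ->
  (forall x y, rect L S (x, y) -> u x y 0 = v x y 0) ->
  (forall x y, rect L S (x, y) -> us x y T = 0) ->
  lateral_zero L S T (jet0 (jetB (jet_of L S v) (jet_of L S u))) ->
  lateral_zero L S T us ->
  (\int[@mu3 R]_(z in box L S (margin T k) (T - margin T k))
     (green_density (jetB (jet_of L S v) (jet_of L S u)) (jet_of L S us) z)%:E
   @[k --> \oo] --> 0)%E.
Proof.
move=> Cu Cv Cus cu cv cus bu bv bus uv0 usT wz usz.
set p := jetB _ _; set q := jet_of L S us.
have Cp : C21_jet L S T p.
  by apply: C21_jetB; exact: C21_jet_of.
have Cq : C21_jet L S T q by exact: C21_jet_of.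
pose f k (z : R * R) :=
  dotv (jet0 p z.1 z.2 (T - margin T k)) (jet0 q z.1 z.2 (T - margin T k))
  - dotv (jet0 p z.1 z.2 (margin T k)) (jet0 q z.1 z.2 (margin T k)).
rewrite (_ : (fun k => _) =
    (fun k => \int[@mu2 R]_(z in rect L S) (f k z)%:E)%E);
  last first.
  apply/funext => k; apply: (@green_box _ _ _ _ T) => //.
  - exact: margin_gt0.
  - exact: margin_lt.
  - by have /andP[] := margin_itvC T_gt0 k.
have [Mu Mu0 uM] := bounded_cyl_ex bu.
have [Mv Mv0 vM] := bounded_cyl_ex bv.
have [Mq Mq0 qM] := bounded_cyl_ex bus.
have pM x y t : rect L S (x, y) -> 0 < t < T -> `|jet0 p x y t| <= Mv + Mu.
  move=> xy tT; apply: (le_trans (ler_normB _ _)).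
  by rewrite lerD //; [exact: vM|exact: uM].
have pqM x y t : rect L S (x, y) -> 0 < t < T ->
    `|dotv (jet0 p x y t) (jet0 q x y t)| <= n%:R * ((Mv + Mu) * Mq).
  move=> xy tT; apply: (le_trans (dotv_le _ _)).
  by rewrite ler_wpM2l// ler_pM//; [exact: pM|exact: qM].
apply: (@cvg_integral_rect0 _ _ _
  (n%:R * ((Mv + Mu) * Mq) + n%:R * ((Mv + Mu) * Mq))).
- move=> k.
  have cpq : {within box L S (margin T k) (T - margin T k), continuous
      (fun z : R * R * R => dotv (unc (jet0 p) z) (unc (jet0 q) z))}.
    have [_ cp _ _ _] := Cp; have [_ cq _ _ _] := Cq.
    apply: continuous_subspaceW (within_continuous_dotv cp cq).
    by rewrite -(bigcup_box_cyl T_gt0) => z zk; exists k.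
  have mk := margin_lt T_gt0 k.
  apply: measurable_funB.
  + by apply: (measurable_box_slice cpq); rewrite lexx (ltW mk).
  + by apply: (measurable_box_slice cpq); rewrite lexx (ltW mk).
- move=> k [x y] xy; apply: (le_trans (ler_normB _ _)).
  apply: lerD; apply: pqM => //.
  + exact: margin_itvC.
  + exact: margin_itv.
- move=> [x y] xy; rewrite -(subrr 0); apply: cvgB.
  + rewrite /=; under eq_fun do rewrite dotvC.
    apply: (@cvg_dotv0 _ _ _ _ (Mv + Mu)).
      rewrite -(usT x y xy); apply: (cvg_time_slice cus xy).
      * by rewrite /= in_itv /= lexx T_gt0.
      * move=> k; rewrite /= in_itv /=.
        by have /andP[-> /ltW ->] := margin_itvC T_gt0 k.
      * exact: cvg_marginC.
    by move=> k; apply: pM => //; exact: margin_itvC.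
  + apply: (@cvg_dotv0 _ _ _ _ Mq).
      have h : v x y (margin T k) - u x y (margin T k) @[k --> \oo]
          --> v x y 0 - u x y 0.
        have A0 : `[0, T[%classic (0 : R) by rewrite /= in_itv /= lexx T_gt0.
        have Am k : `[0, T[%classic (margin T k).
          by rewrite /= in_itv /=; have /andP[/ltW -> ->] := margin_itv T_gt0 k.
        by apply: cvgB; [apply: (cvg_time_slice cv xy A0 Am)
          |apply: (cvg_time_slice cu xy A0 Am)]; exact: cvg_margin.
      by rewrite (uv0 x y xy) subrr in h.
    by move=> k; apply: qM => //; exact: margin_itv.
Qed.

End Comparison.

(** * Sufficiency of the adjoint conditions *)

Lemma heat_opB (V : zmodType) (a b c d e f : V) :
  (a - b) - ((c - d) + (e - f)) = (a - (c + e)) - (b - (d + f)).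
Proof.
rewrite [(c - d) + _]addrACA -opprD !opprB addrACA [RHS]addrACA.
by congr (_ + _); rewrite addrC.
Qed.

(** Membership in the locally adjoint mapping, tested on the direction
    [(v - u, pv - pu)], gives [<pv - pu, q> <= <v - u, a>]; the subgradient
    inequality gives [g u + <v - u, b> <= g v]; and [qs = a - b]. *)
Lemma adjoint_pointwise (R : realType) (n : nat)
    (F : 'rV[R]_n -> set 'rV[R]_n) (g : 'rV[R]_n -> \bar R)
    (u v q pu pv qs : 'rV[R]_n) :
  [set a - b | a in LAM F q (u, pu) & b in subdifferential g u] qs ->
  F v pv ->
  (g u + (dotv (pv - pu) q - dotv (v - u) qs)%:E <= g v)%E.
Proof.
move=> [a aLAM [b bsub <-]] Fv.
have /= h : 0 <= dotv (v - u) a + dotv (pv - pu) (- q).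
  apply: (aLAM (v - u, pv - pu)); exists 1, (v, pv).
  by split => //=; rewrite scale1r.
apply: (le_trans _ (bsub v)); rewrite leeD2l// lee_fin.
by move: h; rewrite dotvDr !dotvNr [dotv b _]dotvC; lra.
Qed.

Theorem theorem5p1 (R : realType) (n : nat) (L S T : R)
    (L_gt0 : 0 < L) (S_gt0 : 0 < S) (T_gt0 : 0 < T)
    (F : 'rV[R]_n -> R -> R -> R -> set 'rV[R]_n)
    (g : 'rV[R]_n -> R -> R -> R -> \bar R)
    (alpha beta0 betaS gamma0 gammaL : R -> R -> 'rV[R]_n)
    (alpha_cont : {within rect L S, continuous (fun p => alpha p.1 p.2)})
    (beta0_cont : {within rect L T, continuous (fun p => beta0 p.1 p.2)})
    (betaS_cont : {within rect L T, continuous (fun p => betaS p.1 p.2)})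
    (gamma0_cont : {within rect S T, continuous (fun p => gamma0 p.1 p.2)})
    (gammaL_cont : {within rect S T, continuous (fun p => gammaL p.1 p.2)})
    (g_hyp : forall x y t, rect L S (x, y) -> 0 <= t <= T ->
       [/\ continuous (fun v => g v x y t),
           convex_efun (fun v => g v x y t) &
           proper (fun v => g v x y t)])
    (F_convex : forall x y t, rect L S (x, y) -> 0 <= t <= T ->
       convex_mapping (fun v => F v x y t))
    (J_wd : forall u, feasible L S T F alpha beta0 betaS gamma0 gammaL u ->
       J_exists L S T g u)
    (u : R -> R -> R -> 'rV[R]_n)
    (u_feasible : feasible L S T F alpha beta0 betaS gamma0 gammaL u)
    (u_adjoint : exists us : R -> R -> R -> 'rV[R]_n,
       [/\ adjoint_regular L S T us,
           adjoint_inclusion L S T F g u us,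
           adjoint_zero_data L S T us &
           maximum_condition L S T F u us]) :
  optimal L S T F g alpha beta0 betaS gamma0 gammaL u.
Proof.
split=> // v v_feasible.
have [us [[Cus cus bus] inclusion [usT [us_y us_x]] _]] := u_adjoint.
have [[Cu cu bu] _ u0 [u_y u_x]] := u_feasible.
have [[Cv cv bv] v_incl v0 [v_y v_x]] := v_feasible.
have [mU qU] := J_wd u u_feasible; have [mV qV] := J_wd v v_feasible.
pose p := jetB (jet_of L S v) (jet_of L S u); pose q := jet_of L S us.
have cylE := bigcup_box_cyl T_gt0 L S.
have cg : {within cyl L S T, continuous (green_density p q)}.
  apply: within_continuous_green; last exact: C21_jet_of.
  by apply: C21_jetB; exact: C21_jet_of.
rewrite /J -cylE.
apply: (@le_integral_exhaustion _ (mspace3 R) R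
  (@mu2 R \x @lebesgue_measure R)%E _ _ _ (green_density p q)).
- exact: nondecreasing_box_margin.
- by move=> k; exact: measurable_box.
- by rewrite cylE.
- by rewrite cylE.
- by rewrite cylE.
- by rewrite cylE.
- move=> k; apply: integrable_box; apply: continuous_subspaceW cg.
  by rewrite -cylE => z zk; exists k.
- rewrite cylE => -[[x y] t] c.
  have := @adjoint_pointwise _ _ (fun w => F w x y t) (fun w => g w x y t)
    _ _ _ _ _ _ (inclusion x y t c) (v_incl x y t c).
  rewrite /green_density /unc /=.
  by rewrite (heat_opB).
- apply: cvg_integral_green => //.
  + by move=> x y xy; rewrite u0 // v0.
  + move=> t tT; split => [x xL|y yS] /=.
      have [-> ->] := u_y x t xL tT; have [-> ->] := v_y x t xL tT.
      by rewrite !subrr.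
    have [-> ->] := u_x y t yS tT; have [-> ->] := v_x y t yS tT.
    by rewrite !subrr.
  + by move=> t tT; split => [x xL|y yS]; [exact: us_y|exact: us_x].
Qed.
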